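(* For all integers $m \ge 0$ and $s \ge 0$ with $s+m \ge 2$, and all $x \in [-1,1]$, the associated Legendre functions satisfy the four-term recurrence $$P_{s+m}^m(x) = 2x\,P_{s+m-1}^m(x) - P_{s+m-2}^m(x) + (2m-1)(1-x^2)^{1/2}\,P_{s+m-1}^{m-1}(x).$$
   Context: For integers $n \ge 0$, the Legendre polynomials are $$P_n(x) = \sum_{k=0}^{\lfloor n/2\rfloor} (-1)^k \frac{(2n-2k)!}{2^n\, k!\,(n-k)!\,(n-2k)!}\, x^{n-2k}.$$ For integers $0 \le m \le n$, the associated Legendre functions (without the Condon–Shortley sign) are $$P_n^m(x) = (1-x^2)^{m/2}\,\frac{d^m}{dx^m}P_n(x),$$ so in particular $P_n^0 = P_n$. Negative upper indices are defined, for $0 < m \le n$, by $$P_n^{-m}(x) = (-1)^m\frac{(n-m)!}{(n+m)!}P_n^m(x).$$ By convention $P_n^m(x) = 0$ whenever $|m| > n$. *)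

(* Defs.v *)
From mathcomp Require Import all_boot all_order all_algebra.
From mathcomp Require Import all_classical all_reals all_analysis.
Set Implicit Arguments.
Unset Strict Implicit.
Unset Printing Implicit Defensive.
Import Order.TTheory GRing.Theory Num.Theory.
Import numFieldNormedType.Exports.
Local Open Scope ring_scope.

Definition legendre (R : realType) (n : nat) : {poly R} :=
  \sum_(k < (n./2).+1)
    ((-1) ^+ k * ((2 * n - 2 * k)`!)%:R /
      (2 ^ n * k`! * (n - k)`! * (n - 2 * k)`!)%:R) *: 'X^(n - 2 * k).

(* [derive1n] is the analytic iterated derivative, and [powR] satisfies
   0 `^ 0 = 1, so that the order 0 function is P_n also at x = 1 and x = -1. *)
Definition assoc_legendre_nat (R : realType) (n m : nat) (x : R) : R :=
  (1 - x ^+ 2) `^ (m%:R / 2) * derive1n m (horner (legendre R n)) x.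

(* [assoc_legendre n m x] is P_n^m(x), without the Condon-Shortley sign, for an
   integer upper index m; [Negz j] is the integer - j.+1. *)
Definition assoc_legendre (R : realType) (n : nat) (m : int) (x : R) : R :=
  if (n < `|m|)%N then 0 else
  match m with
  | Posz k => assoc_legendre_nat n k x
  | Negz j => (-1) ^+ j.+1 * (((n - j.+1)`!)%:R / ((n + j.+1)`!)%:R) *
              assoc_legendre_nat n j.+1 x
  end.

(* Main.v *)
Require Import Defs.
From mathcomp Require Import all_boot all_order all_algebra.
From mathcomp Require Import all_classical all_reals all_analysis.
From mathcomp Require Import zify ring lra.
Import Order.TTheory GRing.Theory Num.Theory.
Import numFieldNormedType.Exports.
Local Open Scope ring_scope.

(** Comparing coefficients gives P'_{n+1} = x P'_n + (n+1) P_n and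
    P'_n = x P'_{n+1} - (n+1) P_{n+1}. For m > 0, their consequence
    P'_{n+2} = 2 x P'_{n+1} - P'_n + P_{n+1} is differentiated m - 1 times by
    Leibniz' rule and multiplied by (1 - x^2)^{m/2}. For m = 0, they express
    (1 - x^2) P'_{n+1} in terms of P_{n+1} and either P_n or P_{n+2}, which
    settles the claim, because the last term of the recurrence is
    (1 - x^2) P'_{n+1} / ((n + 1)(n + 2)). *)

(** With the degree written as [j + 2 * k], the monomial of degree [j] is the summand of index [k],
    and no truncated subtraction or halving remains. *)
Lemma coef_legendre (R : realType) (j k : nat) :
  (legendre R (j + 2 * k))`_j =
  (-1) ^+ k * ((2 * (j + k))`!)%:R /
    (2 ^ (j + 2 * k) * k`! * (j + k)`! * j`!)%:R.
Proof.
have hk : (k < ((j + 2 * k)./2).+1)%N by lia.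
rewrite /legendre coef_sum (bigD1 (Ordinal hk)) //= big1 ?addr0; last first.
  move=> i /eqP hi; rewrite coefZ coefXn.
  case: eqP => [jE|_]; last by rewrite mulr0.
  case: hi; apply: val_inj => /=; have := ltn_ord i; lia.
rewrite coefZ coefXn addnK eqxx mulr1.
by congr (_ * (_`!)%:R / (_ * _ * _`! * _)%:R); lia.
Qed.

Lemma coef_legendre_eq0 (R : realType) (n j : nat) :
  (n < j)%N || odd (n + j) -> (legendre R n)`_j = 0.
Proof.
move=> hj; rewrite /legendre coef_sum big1 // => i _; rewrite coefZ coefXn.
case: eqP => [jE|_]; last by rewrite mulr0.
have := ltn_ord i; lia.
Qed.

Lemma coefX_deriv (R : nzRingType) (p : {poly R}) (j : nat) :
  ('X * p^`())`_j = p`_j *+ j.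
Proof. by rewrite coefXM; case: j => [|j] /=; rewrite ?mulr0n ?coef_deriv. Qed.

Lemma fact_doubleS (n : nat) :
  ((2 * n.+1)`! = 2 * n.+1 * (2 * n).+1 * (2 * n)`!)%N.
Proof. by rewrite mulnS add2n !factS mulnA. Qed.

Lemma deriv_legendreS (R : realType) (n : nat) :
  (legendre R n.+1)^`() = 'X * (legendre R n)^`() + legendre R n *+ n.+1.
Proof.
apply/polyP => j; rewrite coefD coefX_deriv coefMn coef_deriv.
rewrite -[LHS]mulr_natl -[X in X + _]mulr_natl -[X in _ + X]mulr_natl.
have [hj|] := boolP ((n < j)%N || odd (n + j)).
  rewrite !coef_legendre_eq0 ?mulr0 ?addr0 //; lia.
rewrite negb_or -leqNgt => /andP[jn njE].
have [k ->] : exists k, n = (j + 2 * k)%N by exists ((n - j)./2); lia.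
(* Raising degree and exponent together keeps [k], so the three coefficients share their sign and
   [k!]. *)
rewrite -[(j + 2 * k).+1]/(j.+1 + 2 * k)%N !coef_legendre.
rewrite addSn fact_doubleS.
rewrite !addSn expnS !factS !natrM.
have fact_neq0 i : i`!%:R != 0 :> R by rewrite pnatr_eq0 -lt0n fact_gt0.
have := fact_neq0 j; have := fact_neq0 k; have := fact_neq0 (j + k)%N.
have : (2 ^ (j + 2 * k))%:R != 0 :> R by rewrite pnatr_eq0 expn_eq0.
have : (j + k).+1%:R != 0 :> R by rewrite pnatr_eq0.
have : j.+1%:R != 0 :> R by rewrite pnatr_eq0.
rewrite -!natr1 !natrD.
move: (_`!)%:R (_`!)%:R (_`!)%:R (_`!)%:R (2 ^ _)%:R ((-1) ^+ k) j%:R k%:R.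
move=> F f1 f2 f3 p e a b a1 ab1 p0 f30 f20 f10.
by field; rewrite f10 f30 f20 p0 a1 ab1.
Qed.

Lemma deriv_legendre (R : realType) (n : nat) :
  (legendre R n)^`() = 'X * (legendre R n.+1)^`() - legendre R n.+1 *+ n.+1.
Proof.
apply/polyP => j; rewrite coefB coefX_deriv coefMn coef_deriv.
rewrite -[LHS]mulr_natl -[X in X - _]mulr_natl -[X in _ - X]mulr_natl.
have [hj|] := boolP ((n.+1 < j)%N || odd (n.+1 + j)).
  rewrite !coef_legendre_eq0 ?mulr0 ?subr0 //; lia.
rewrite negb_or -leqNgt => /andP[jn njE].
(* Since n = (j + 1) + 2 (k - 1), the index drops by one in P_n. The case k = 0 is the top degree j
   = n + 1: the right side cancels and P_n has no term of degree n + 2. *)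
have [[|k] nE] : exists k, n.+1 = (j + 2 * k)%N by exists ((n.+1 - j)./2); lia.
  rewrite (_ : j = n.+1); last by lia.
  by rewrite subrr coef_legendre_eq0 ?mulr0 // ltnS ltnW.
rewrite nE (_ : n = (j.+1 + 2 * k)%N); last by lia.
rewrite !coef_legendre.
rewrite (_ : j + 2 * k.+1 = (j + 2 * k).+2)%N; last by lia.
rewrite -[(j + k.+1)%N]addSnnS !addSn.
rewrite !factS !expnS exprS !natrM.
have fact_neq0 i : i`!%:R != 0 :> R by rewrite pnatr_eq0 -lt0n fact_gt0.
have := fact_neq0 j; have := fact_neq0 k; have := fact_neq0 (j + k)%N.
have : (2 ^ (j + 2 * k))%:R != 0 :> R by rewrite pnatr_eq0 expn_eq0.
have : (j + k).+1%:R != 0 :> R by rewrite pnatr_eq0.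
have : j.+1%:R != 0 :> R by rewrite pnatr_eq0.
have : k.+1%:R != 0 :> R by rewrite pnatr_eq0.
rewrite -!natr1 !natrD.
move: (_`!)%:R (_`!)%:R (_`!)%:R (_`!)%:R (2 ^ _)%:R ((-1) ^+ k) j%:R k%:R.
move=> F f1 f2 f3 p e a b b1 a1 ab1 p0 f30 f20 f10.
by field; rewrite f10 f30 f20 p0 a1 b1 ab1.
Qed.

Lemma deriv_legendreSS (R : realType) (n : nat) :
  (legendre R n.+2)^`() =
  'X * (legendre R n.+1)^`() *+ 2 - (legendre R n)^`() + legendre R n.+1.
Proof.
by rewrite deriv_legendreS (deriv_legendre R n); ring.
Qed.

(** Rewriting one P'_n through P'_{n+1} and back recreates X^2 P'_n, which cancels. The next lemma
    makes the same round trip from P'_{n+1}. *)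
Lemma sub1X2_deriv_legendre (R : realType) (n : nat) :
  (1 - 'X^2) * (legendre R n)^`() =
  ('X * legendre R n - legendre R n.+1) *+ n.+1.
Proof.
by rewrite mulrBl {1}deriv_legendre deriv_legendreS; ring.
Qed.

Lemma sub1X2_deriv_legendreS (R : realType) (n : nat) :
  (1 - 'X^2) * (legendre R n.+1)^`() =
  (legendre R n - 'X * legendre R n.+1) *+ n.+1.
Proof.
by rewrite mulrBl {1}deriv_legendreS deriv_legendre; ring.
Qed.

Lemma derivn_mulX_deriv (R : comNzRingType) (p : {poly R}) (k : nat) :
  ('X * p^`())^`(k) = 'X * p^`(k.+1) + p^`(k) *+ k.
Proof.
elim: k => [|k IHk]; first by rewrite !derivn0 addr0.
rewrite derivnS IHk derivD derivM derivX mul1r derivMn -!derivnS.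
by rewrite mulrS addrCA addrA.
Qed.

(** Leibniz' rule on 2 X P'_{n+1} contributes [2 * k], and the summand P_{n+1} contributes 1; for m
    = k + 1 the total is 2 m - 1. *)
Lemma derivn_legendre (R : realType) (n k : nat) :
  (legendre R n.+2)^`(k.+1) =
  'X * (legendre R n.+1)^`(k.+1) *+ 2 - (legendre R n)^`(k.+1)
  + (legendre R n.+1)^`(k) *+ (2 * k).+1.
Proof.
rewrite derivSn deriv_legendreSS derivnD derivnB -derivSn.
by rewrite derivnMn derivn_mulX_deriv; ring.
Qed.

Lemma size_legendre (R : realType) (n : nat) : (size (legendre R n) <= n.+1)%N.
Proof. by apply/leq_sizeP => j nj; rewrite coef_legendre_eq0 // nj. Qed.

Lemma derive1n_horner (R : realType) (p : {poly R}) (n : nat) :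
  derive1n n (horner p) = horner p^`(n).
Proof.
by elim: n => [|n IHn]; rewrite ?derive1n0 // derive1nS IHn -derivE -derivnS.
Qed.

(** The convention for m > n agrees with the formula, because the m-th derivative of a polynomial of
    degree at most n vanishes. This spares a case split on the degrees. *)
Lemma assoc_legendre_posE (R : realType) (n m : nat) (x : R) :
  assoc_legendre n m%:Z x =
  (1 - x ^+ 2) `^ (m%:R / 2) * (legendre R n)^`(m).[x].
Proof.
rewrite /assoc_legendre /assoc_legendre_nat derive1n_horner /=.
case: ifP => // nm; rewrite derivn_poly0 ?horner0 ?mulr0 //.
exact: leq_trans (size_legendre R n) nm.
Qed.

Theorem mainTheorem1 (R : realType) (m s : nat) (hsm : (2 <= s + m)%N)
    (x : R) (hx : -1 <= x <= 1) :
  assoc_legendre (s + m) m%:Z x =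
    2 * x * assoc_legendre (s + m - 1) m%:Z x
    - assoc_legendre (s + m - 2) m%:Z x
    + (2 * m%:R - 1) * (1 - x ^+ 2) `^ (1 / 2)
      * assoc_legendre (s + m - 1) (m%:Z - 1) x.
Proof.
have [n sE] : exists n, (s + m)%N = n.+2 by exists (s + m - 2)%N; lia.
rewrite sE subn1 subn2 /= !assoc_legendre_posE.
have x2_ge0 : 0 <= 1 - x ^+ 2 by nra.
case: m {hsm sE} => [|k].
  (* For m = 0 the sign in P_{n+1}^{-1} cancels the factor 2 m - 1 = -1. *)
  rewrite (_ : 0%:Z - 1 = Negz 0) // /assoc_legendre /=.
  rewrite /assoc_legendre_nat derive1n_horner derivn1 expr1.
  rewrite subn1 addn1 mul0r powRr0 [n.+1.-1]/=.
  rewrite !mul1r mulr0 sub0r.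
  set P0 := (legendre R n).[x]; set P1 := (legendre R n.+1).[x].
  set P2 := (legendre R n.+2).[x]; set D := (legendre R n.+1)^`().[x].
  have P0E : (1 - x ^+ 2) * D = n.+1%:R * (P0 - x * P1).
    have := congr1 (horner^~ x) (sub1X2_deriv_legendreS R n).
    by rewrite mulr_natl /= hornerMn !hornerE.
  have P2E : (1 - x ^+ 2) * D = n.+2%:R * (x * P1 - P2).
    have := congr1 (horner^~ x) (sub1X2_deriv_legendre R n.+1).
    by rewrite mulr_natl /= hornerMn !hornerE.
  have n1 : n.+1%:R != 0 :> R by rewrite pnatr_eq0.
  have n2 : n.+2%:R != 0 :> R by rewrite pnatr_eq0.
  have nf : n`!%:R != 0 :> R by rewrite pnatr_eq0 -lt0n fact_gt0.
  set w := (1 - x ^+ 2) `^ 2^-1.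
  have w2 : w * w = 1 - x ^+ 2.
    by rewrite -powRD -div1r -?splitr ?powRr1 // oner_eq0.
  rewrite -w2 in P0E P2E.
  (* Eliminating [P0] and [P2] reduces the claim to 1/(n+1) - 1/(n+2) = 1/((n+1)(n+2)). *)
  have {P0E} -> : P0 = x * P1 + w * w * D / n.+1%:R by rewrite P0E; field.
  have {P2E} -> : P2 = x * P1 - w * w * D / n.+2%:R by rewrite P2E; field.
  rewrite !factS !natrM.
  by field; rewrite nf nat1r -natrD !pnatr_eq0.
have -> : k.+1%:Z - 1 = k%:Z by lia.
rewrite assoc_legendre_posE derivn_legendre.
have -> : (1 - x ^+ 2) `^ (k.+1%:R / 2) =
    (1 - x ^+ 2) `^ (1 / 2) * (1 - x ^+ 2) `^ (k%:R / 2).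
  (* The base vanishes at x = 1 and x = -1, where adding exponents is licensed by 1/2 + k/2 > 0. *)
  rewrite -powRD; first by congr (_ `^ _); rewrite -natr1; field.
  by rewrite gt_eqF // ltr_wpDr ?divr_ge0 // divr_gt0.
by rewrite !(hornerD, hornerN, hornerMn, hornerM, hornerX); ring.
Qed.
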